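(* Let $n,N\ge 1$, let $A=\{a_0,\dots,a_{n-1}\}\subseteq\{0,1,\dots,N-1\}$ be a set of $n$ distinct residues that is valid mod $N$, let $p\equiv\sum_j a_j\pmod N$, and let $\omega=e^{2\pi i/N}$. Then for every $B=(b_{ij})\in\mathbb{C}^{n\times n}$, $$\operatorname{per} B=\frac1N\sum_{r=0}^{N-1}\omega^{-pr}\prod_{i=1}^n\Bigl(\sum_{j=0}^{n-1} b_{ij}\,\omega^{a_jr}\Bigr).$$
   Context: Matrices $B=(b_{ij})\in\mathbb{C}^{n\times n}$ have rows indexed by $i=1,\dots,n$ and columns indexed by $j=0,\dots,n-1$. The permanent is $\operatorname{per} B=\sum_{\sigma}\prod_{i=1}^n b_{i\sigma(i)}$, the sum being over all bijections $\sigma:\{1,\dots,n\}\to\{0,\dots,n-1\}$. The set $A=\{a_0,\dots,a_{n-1}\}$ is valid mod $N$ if the all-ones multiset (each element of $A$ taken exactly once) is the only size-$n$ multiset with elements from $A$ whose sum is $\sum_j a_j$ modulo $N$; equivalently, the only $k\in\mathbb{Z}_{\ge0}^{\,n}$ with $\sum_j k_j=n$ and $\sum_j k_ja_j\equiv\sum_j a_j\pmod N$ is $k=(1,\dots,1)$. *)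

(* Defs.v *)
From HB Require Import structures.
From mathcomp Require Import all_boot all_order all_algebra all_fingroup.
From mathcomp Require Import complex.
From mathcomp Require Import all_classical all_reals all_analysis.

Set Implicit Arguments.
Unset Strict Implicit.
Unset Printing Implicit Defensive.

Import Order.TTheory GRing.Theory Num.Theory.
Local Open Scope ring_scope.

(* Rows {1, ..., n} and columns {0, ..., n-1} are both represented by 'I_n
   (row i being the ordinal i - 1), so that a bijection from rows to columns
   is a permutation of 'I_n. *)
Definition per (K : comNzRingType) (n : nat) (B : 'M[K]_n) : K :=
  \sum_(s : 'S_n) \prod_(i < n) B i (s i).

(* A size-n multiset with elements from {a_0, ..., a_(n-1)} is given by its
   multiplicities k : 'I_n -> nat; injectivity of a, which makes k unambiguous,
   is not part of this definition. *)
Definition valid_mod (n N : nat) (a : 'I_n -> 'I_N) : Prop :=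
  forall k : 'I_n -> nat,
    (\sum_(j < n) k j)%N = n ->
    (\sum_(j < n) k j * a j = \sum_(j < n) a j %[mod N])%N ->
    forall j : 'I_n, k j = 1%N.

Definition cexp (R : realType) (z : R[i]) : R[i] :=
  (expR (complex.Re z))%:C%C
    * (cos (complex.Im z) +i* sin (complex.Im z))%C.

Definition omega (R : realType) (N : nat) : R[i] :=
  cexp (2%:R * (pi : R)%:C%C * 'i%C / N%:R).

(* Main.v *)
(* Expanding the product of row sums indexes the right-hand side by all maps
   f from rows to columns, each weighted by the r-average of
   omega ^ ((sum_i a_(f i) - p) r). By orthogonality of the powers of a
   primitive N-th root of unity this average is 1 when
   sum_i a_(f i) = sum_j a_j mod N and 0 otherwise. The fibre sizes of f form
   a size-n multiset, so validity leaves exactly the bijective f. *)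
Require Import Defs.
From mathcomp Require Import all_boot all_order all_algebra all_fingroup.
From mathcomp Require Import complex.
From mathcomp Require Import all_classical all_reals all_analysis.
From mathcomp Require Import ring lra.

Import Order.TTheory GRing.Theory Num.Theory.
Local Open Scope ring_scope.

(** Permutations are a subtype of finite functions, so the sum reindexes along [pval]. *)
Lemma per_sum_injective (K : comNzRingType) (n : nat) (B : 'M[K]_n) :
  per B = \sum_(f : {ffun 'I_n -> 'I_n} | injectiveb f) \prod_i B i (f i).
Proof.
rewrite /per (reindex (@pval _)) /=; last first.
  (* The default [1%g] is reached only at non-injective [f], outside the range of summation. *)
  exists (fun f => insubd (1%g : 'S_n) f) => [s _|f f_inj].
    by apply: val_inj; rewrite val_insubd [injectiveb _](valP s).
  by rewrite [LHS]val_insubd [injectiveb _]f_inj.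
apply: eq_big => [s|s _]; first by rewrite [injectiveb _](valP s).
by apply: eq_bigr => i _; rewrite pvalE.
Qed.

(** Serves both premises of validity: constant weight 1 gives the size of the multiset of fibre
    sizes, the residues as weights give its sum. *)
Lemma sum_fibers (n : nat) (f : 'I_n -> 'I_n) (a : 'I_n -> nat) :
  (\sum_(j < n) #|[set i | f i == j]| * a j = \sum_(i < n) a (f i))%N.
Proof.
rewrite [RHS](partition_big f predT) //=; apply: eq_bigr => j _.
rewrite -sum_nat_const; apply: eq_big => [i|i]; first by rewrite inE.
by rewrite inE => /eqP ->.
Qed.

(** Validity makes every fibre of [f] a singleton; conversely, an injective [f] only permutes the
    summands. *)
Lemma valid_mod_injectiveb (n N : nat) (a : 'I_n -> 'I_N) (f : 'I_n -> 'I_n) :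
  valid_mod a ->
  (\sum_(i < n) a (f i) == \sum_(j < n) a j %[mod N])%N = injectiveb f.
Proof.
move=> a_valid; apply/eqP/injectiveP => [sum_af | f_inj]; last first.
  by rewrite [in RHS](reindex_inj f_inj).
have fiber1 : forall j, #|[set i | f i == j]| = 1%N.
  apply: a_valid; last by rewrite (sum_fibers _ f (fun j => a j)).
  have := sum_fibers _ f (fun=> 1%N); under eq_bigr do rewrite muln1.
  by move=> ->; rewrite sum1_card card_ord.
move=> i i' ff; have /eqP/cards1P[x fx] := fiber1 (f i).
have : i \in [set i0 | f i0 == f i] by rewrite inE.
have : i' \in [set i0 | f i0 == f i] by rewrite inE ff.
by rewrite fx !inE => /eqP -> /eqP ->.
Qed.

Lemma sum_expr_unity (K : fieldType) (N : nat) (z : K) :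
  z ^+ N = 1 -> \sum_(0 <= r < N) z ^+ r = if z == 1 then N%:R else 0.
Proof.
move=> zN; case: eqVneq => [->|z1].
  under eq_bigr do rewrite expr1n.
  by rewrite big_const_nat subn0 iter_addr_0.
have /eqP : (z - 1) * \sum_(r < N) z ^+ r = 0 by rewrite -subrX1 zN subrr.
by rewrite mulf_eq0 subr_eq0 (negbTE z1) /= big_mkord => /eqP.
Qed.

(** Lets [p] be any integer representative of its class, possibly negative. *)
Lemma prim_root_exprz_mod (K : fieldType) (N : nat) (w : K) (p q : int) :
  N.-primitive_root w -> (p = q %[mod N%:Z])%Z -> w ^ p = w ^ q.
Proof.
move=> w_prim pq; have w0 : w != 0.
  by rewrite (prim_root_eq0 w_prim) -lt0n (prim_order_gt0 w_prim).
have wN k : w ^ (k * N%:Z) = 1.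
  by rewrite mulrC -exprz_exp -exprnP prim_expr_order // exp1rz.
by rewrite (divz_eq p N) (divz_eq q N) pq !expfzDr // !wN !mul1r.
Qed.

(** The identity is purely algebraic: a primitive [N]-th root of unity in a field already forces
    [N%:R] to be invertible. *)
Lemma per_prim_root (K : fieldType) (n N : nat) (w : K) (a : 'I_n -> 'I_N)
    (p : int) (B : 'M[K]_n) :
  N.-primitive_root w -> valid_mod a ->
  (p = (\sum_(j < n) a j)%N%:Z %[mod N%:Z])%Z ->
  per B =
    N%:R^-1 * \sum_(0 <= r < N)
      (w ^ (- (p * r%:Z))
       * \prod_(i < n) \sum_(j < n) (B i j * w ^+ (a j * r)%N)).
Proof.
move=> w_prim a_valid hp; have N0 := prim_root_natf_neq0 w_prim.
have w0 : w != 0.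
  by rewrite (prim_root_eq0 w_prim) -lt0n (prim_order_gt0 w_prim).
set S := (\sum_(j < n) a j)%N in hp.
(* All dependence on [r] in the term of [f] is the factor [z f ^+ r], so summing over [r] gives a
   geometric sum of an [N]-th root of unity. *)
pose z (f : {ffun 'I_n -> 'I_n}) := w ^+ (\sum_(i < n) a (f i)) / w ^+ S.
have zE (f : {ffun _}) r :
    w ^ (- (p * r%:Z)) * \prod_(i < n) (B i (f i) * w ^+ (a (f i) * r)%N) =
    (\prod_(i < n) B i (f i)) * z f ^+ r.
  rewrite big_split /= mulrCA; congr (_ * _).
  rewrite prodrXr -big_distrl /= exprM /z exprMn mulrC; congr (_ * _).
  by rewrite -invr_expz -exprz_exp (prim_root_exprz_mod _ _ _ _ _ w_prim hp)
    -!exprnP exprVn.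
have sum_z f : \sum_(0 <= r < N) z f ^+ r = if injectiveb f then N%:R else 0.
  rewrite sum_expr_unity.
    rewrite -(valid_mod_injectiveb _ _ _ _ a_valid) -(eq_prim_root_expr w_prim).
    by rewrite /z -subr_eq0 -[1](divff (expf_neq0 S w0)) -mulrBl mulf_eq0
      invr_eq0 (negbTE (expf_neq0 S w0)) orbF subr_eq0.
  by rewrite /z exprMn exprVn ![w ^+ _ ^+ N]exprAC
    (prim_expr_order w_prim) !expr1n divr1.
under eq_bigr => r _.
  rewrite bigA_distr_bigA mulr_sumr; under eq_bigr do rewrite zE.
  over.
rewrite exchange_big /= mulr_sumr per_sum_injective big_mkcond /=.
apply: eq_bigr => f _; rewrite -mulr_sumr sum_z.
by case: ifP => _; rewrite ?mulr0 // mulrCA mulVf // mulr1.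
Qed.

Lemma cis_expr (R : realType) (t : R) (k : nat) :
  ((cos t +i* sin t) ^+ k = cos (t *+ k) +i* sin (t *+ k))%C.
Proof.
elim: k => [|k IHk]; first by rewrite expr0 mulr0n cos0 sin0.
rewrite exprS IHk mulrS cosD sinD; apply/eqP; rewrite eq_complex /=.
by rewrite eqxx addrC eqxx.
Qed.

(** Half-angle formula: [cos t] is 1 minus twice the square of [sin (t / 2)], and [t / 2] lies
    strictly between 0 and [pi]. *)
Lemma cos_lt1 (R : realType) (t : R) : 0 < t < 2 * pi -> cos t < 1.
Proof.
move=> /andP[t0 t2pi].
have s0 : 0 < sin (t / 2) by apply: sin_gt0_pi; lra.
have -> : t = (t / 2) *+ 2 by rewrite -mulr_natr divfK.
rewrite cos_mulr2n; have := cos2Dsin2 (t / 2).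
have : 0 < sin (t / 2) ^+ 2 by rewrite exprn_gt0.
lra.
Qed.

Lemma omegaE (R : realType) (N : nat) :
  omega R N = (cos (2 * pi / N%:R) +i* sin (2 * pi / N%:R))%C.
Proof.
rewrite /omega.
have -> : (2%:R * (pi : R)%:C * 'i / N%:R = 0 +i* (2 * pi / N%:R))%C.
  rewrite -(rmorph_nat (real_complex R) 2) -(rmorph_nat (real_complex R) N).
  rewrite -fmorphV /=; apply/eqP; rewrite eq_complex /=.
  by apply/andP; split; apply/eqP; ring.
by rewrite /cexp /= expR0 rmorph1 mul1r.
Qed.

(** The exact order [m] divides [N]. If [m < N], the real part of [omega R N ^+ m] is the cosine of
    an angle strictly between 0 and [2 * pi], so it cannot be 1. *)
Lemma omega_prim_root (R : realType) (N : nat) :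
  (0 < N)%N -> N.-primitive_root (omega R N).
Proof.
move=> N_gt0; have N0 : N%:R != 0 :> R by rewrite pnatr_eq0 -lt0n.
have omegaX k : omega R N ^+ k =
    (cos (2 * pi / N%:R *+ k) +i* sin (2 * pi / N%:R *+ k))%C.
  by rewrite omegaE cis_expr.
have omegaN : omega R N ^+ N = 1.
  by rewrite omegaX -mulr_natr divfK // mulr_natl cos2pi sin2pi.
have [m m_prim mN] := prim_order_exists N_gt0 omegaN.
have [eq_mN|neq_mN] := eqVneq m N; first by rewrite -{1}eq_mN.
have lt_mN : (m < N)%N by rewrite ltn_neqAle neq_mN dvdn_leq.
have /(congr1 (@complex.Re R)) := prim_expr_order m_prim.
rewrite omegaX /= => cos1.
suff : cos (2 * (pi : R) / N%:R *+ m) < 1 by rewrite cos1 ltxx.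
apply: cos_lt1; have pi2_gt0 : 0 < 2 * (pi : R) by rewrite mulr_gt0 ?pi_gt0.
have m_gt0 := prim_order_gt0 m_prim.
rewrite -mulr_natr mulrAC ltr_pdivrMr ?ltr0n // ltr_pM2l // ltr_nat.
by rewrite lt_mN andbT divr_gt0 ?(mulr_gt0 pi2_gt0) ?ltr0n.
Qed.

Theorem proposition4 (R : realType) (n N : nat) (hn : (0 < n)%N)
    (hN : (0 < N)%N) (a : 'I_n -> 'I_N) (a_inj : injective a)
    (a_valid : valid_mod a) (p : int)
    (hp : (p = (\sum_(j < n) a j)%N%:Z %[mod N%:Z])%Z) (B : 'M[R[i]]_n) :
  per B =
    N%:R^-1 * \sum_(0 <= r < N)
      (omega R N ^ (- (p * r%:Z))
       * \prod_(i < n) \sum_(j < n) (B i j * omega R N ^+ (a j * r)%N)).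
Proof.
by apply: per_prim_root => //; exact: omega_prim_root.
Qed.
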